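(* For every integer $n\ge 0$, $$B_{n}=\sum_{k=0}^{n}(-1)^{n-k}B_{k}^{L}S_{2}(n,k).$$
   Context: $S_2(n,k)$ is the Stirling number of the second kind: the number of ways to partition a set of $n$ elements into $k$ nonempty subsets. $B_n=\sum_{k=0}^n S_2(n,k)$ is the $n$-th Bell number. For integers $n,k\ge 0$, the unsigned Lah number $L(n,k)$ is the number of ways a set of $n$ elements can be partitioned into $k$ nonempty linearly ordered subsets (so $L(0,0)=1$, $L(n,0)=0$ for $n\ge 1$, $L(n,k)=0$ for $k>n$, and $L(n,k)=\binom{n-1}{k-1}\frac{n!}{k!}$ for $n\ge k\ge 1$). The $n$-th Lah-Bell number is $B_n^L=\sum_{k=0}^n L(n,k)$. *)

(* Defs.v *)
From mathcomp Require Import all_boot all_order all_algebra.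

Set Implicit Arguments.
Unset Strict Implicit.
Unset Printing Implicit Defensive.

(* [partition P D] includes [set0 \notin P], so blocks are nonempty. *)
Definition stirling2 (n k : nat) : nat :=
  #|[set P : {set {set 'I_n}} | partition P [set: 'I_n] & #|P| == k]|.

Definition bell (n : nat) : nat := \sum_(0 <= k < n.+1) stirling2 n k.

(* The graphs of the (non-strict) linear orders on B; reflexivity on B is the
   case x = y of totality. *)
Definition linear_orders (T : finType) (B : {set T}) : {set {set T * T}} :=
  [set R : {set T * T} |
    [&& R \subset setX B B,
        [forall x in B, forall y in B, ((x, y) \in R) || ((y, x) \in R)],
        [forall x, forall y, ((x, y) \in R) && ((y, x) \in R) ==> (x == y)] &
        [forall x, forall y, forall z,
           ((x, y) \in R) && ((y, z) \in R) ==> ((x, z) \in R)]]].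

(* Pairs of a partition P into k blocks and a function f such that f B is a
   linear order on B for each block B of P; f takes the dummy value set0 off P,
   so that each choice of orders on the blocks is counted once. *)
Definition lah (n k : nat) : nat :=
  #|[set Pf : {set {set 'I_n}} * {ffun {set 'I_n} -> {set 'I_n * 'I_n}} |
      [&& partition Pf.1 [set: 'I_n], #|Pf.1| == k &
          Pf.2 \in pfamily set0 Pf.1 (@linear_orders 'I_n)]]|.

Definition lah_bell (n : nat) : nat := \sum_(0 <= k < n.+1) lah n k.

(* Main.v *)
Require Import Defs.
From mathcomp Require Import all_boot all_order all_algebra.
From mathcomp Require Import ring.

Import Order.TTheory GRing.Theory Num.Theory.
Local Open Scope ring_scope.

Set Implicit Arguments.
Unset Strict Implicit.
Unset Printing Implicit Defensive.

(** The identity holds coefficient by coefficient: for every j,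
<<
      S_2(n, j) = \sum_k (-1)^(n - k) S_2(n, k) L(k, j),
>>
    and summing over j gives the theorem ([lah_stirling2] is this refinement).
    It follows by induction on n from the two triangular recurrences
<<
      S_2(n+1, k) = S_2(n, k-1) + k S_2(n, k)
      L(n+1, k)   = L(n, k-1) + (n + k) L(n, k).
>>
    Expanding S_2(n+1, k) on the right and shifting the index replaces L(k, j)
    by L(k+1, j) - k L(k, j), which is L(k, j-1) + j L(k, j): the k-dependent
    part of the Lah recurrence cancels, and the right-hand side obeys the
    recurrence of S_2 in (n, j).

    Both recurrences are cases of one. Give a partition P the weight
    \prod_(B in P) w |B|, so that w = 1 counts partitions and w m = m! counts
    partitions with linearly ordered blocks ([card_linear_orders]). A new point
    either forms a block of its own or joins some block B. If w 1 = 1 and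
    w (m + 1) = (a m + b) w m for m > 0, then joining B multiplies the weight
    by a |B| + b, and these factors add up over the k blocks of a partition of
    an n-set to a n + b k, whatever the sizes of the blocks. The Stirling
    numbers have (a, b) = (0, 1) and the Lah numbers have (a, b) = (1, 1). *)

(** * Adding a point to a set partition *)

Lemma partition_setU1 (T : finType) (D B : {set T}) (Q : {set {set T}}) :
    B \subset D -> B != set0 -> partition Q (D :\: B) ->
  partition (B |: Q) D /\ B \notin Q.
Proof.
move=> sBD B0 partQ; split.
  rewrite -[D](setID D B) (setIidPr sBD).
  by apply: partitionU1; rewrite // disjoint_sym disjoints_subset subsetDr.
apply/negP => /(partitionS partQ); rewrite subsetD => /andP[_].
by rewrite -setI_eq0 setIid (negPf B0).
Qed.

(** A partition with a marked block B amounts to a nonempty subset B together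
    with a partition of the rest. *)
Lemma sum_marked_block (T : finType) (D : {set T})
    (G : {set T} -> {set {set T}} -> nat) :
  (\sum_(P | partition P D) \sum_(B in P) G B (P :\ B) =
   \sum_(B : {set T} | (B \subset D) && (B != set0))
      \sum_(Q | partition Q (D :\: B)) G B Q)%N.
Proof.
rewrite (exchange_big_dep (fun B : {set T} => (B \subset D) && (B != set0))) /=.
  apply: eq_bigr => B /andP[sBD B0].
  rewrite (reindex_onto (fun Q => B |: Q) (fun P => P :\ B)) /=; last first.
    by move=> P /andP[_ BP]; rewrite setD1K.
  apply: eq_big => [Q | Q /andP[/andP[partP _] /eqP ->] //].
  apply/andP/idP => [[/andP[partP BP] /eqP <-] | partQ].
    by rewrite partitionD1.
  have [-> BQ] := partition_setU1 sBD B0 partQ.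
  by rewrite setU11 setU1K.
by move=> P B partP BP; rewrite (partitionS partP BP) (partition_neq0 partP BP).
Qed.

(** Mark in each partition of [a |: A] the block [a |: B] of [a]. What remains is
    a subset [B] of [A] and a partition of [A :\: B]; if [B] is nonempty, this is
    again a partition of [A] with a marked block. So [sum_marked_block] applies
    once in each direction. *)
Lemma sum_partition_setU1 (T : finType) (a : T) (A : {set T})
    (F : {set {set T}} -> nat) :
  a \notin A ->
  (\sum_(P | partition P (a |: A)) F P =
   \sum_(P | partition P A)
      (F ([set a] |: P) + \sum_(B in P) F ((a |: B) |: (P :\ B))))%N.
Proof.
move=> aA.
(* Exactly one block contains a, so marking it does not change the sum. *)
transitivity (\sum_(P | partition P (a |: A))
    \sum_(B in P) (if a \in B then F (B |: (P :\ B)) else 0))%N.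
  apply: eq_bigr => P partP.
  have aP : a \in cover P by rewrite (cover_partition partP) setU11.
  rewrite (bigD1 (pblock P a)) ?pblock_mem //= mem_pblock aP setD1K ?pblock_mem //.
  rewrite big1 ?addn0 // => B /andP[BP neqB]; case: ifP => // aB.
  by rewrite (def_pblock (partition_trivIset partP) BP aB) eqxx in neqB.
rewrite (sum_marked_block _ (fun B Q => if a \in B then F (B |: Q) else 0%N)).
(* The marked block is replaced by its trace on A, which may be empty. *)
transitivity (\sum_(B : {set T} | B \subset A)
    \sum_(Q | partition Q (A :\: B)) F ((a |: B) |: Q))%N.
  rewrite (bigID (fun B : {set T} => a \in B)) /= addnC big1 ?add0n; last first.
    by move=> B /andP[_ /negPf ->]; rewrite big1.
  rewrite (reindex_onto (fun B => a |: B) (fun B => B :\ a)) /=; last first.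
    by move=> B /andP[_ aB]; rewrite setD1K.
  apply: eq_big => [B | B].
    rewrite setU11 andbT; apply/andP/idP => [[/andP[sB _] /eqP <-] | sB].
      by rewrite subDset.
    rewrite setUS // setU1K ?(contra (subsetP sB a)) //; split=> //.
    by apply/set0Pn; exists a; rewrite setU11.
  case/andP=> _ /eqP defB.
  suff -> : (a |: A) :\: (a |: B) = A :\: B by apply: eq_bigr => Q _; rewrite setU11.
  apply/setP=> x; rewrite !inE; case: eqP => //= ->.
  by rewrite (negPf aA) andbF.
(* The empty trace is the case where a forms a block of its own. *)
rewrite (bigD1 set0) ?sub0set //= setD0 setU0 big_split /=; congr addn.
by rewrite (sum_marked_block _ (fun B Q => F ((a |: B) |: Q))).
Qed.

(** * Weighted counts of partitions *)

Definition weighted_partitions (w : nat -> nat) (T : finType) (D : {set T}) k :=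
  (\sum_(P : {set {set T}} | partition P D) (#|P| == k) * \prod_(B in P) w #|B|)%N.

(** Enlarging a block B multiplies the weight by an affine function of |B|, and
    the block sizes add up to #|A|; this is why the sum over the blocks depends
    on the partition only through the number of its blocks. *)
Lemma weighted_partitions_setU1 (w : nat -> nat) a b (T : finType) x
    (A : {set T}) k :
    w 1 = 1%N -> (forall m, w m.+2 = (a * m.+1 + b) * w m.+1)%N -> x \notin A ->
  (weighted_partitions w (x |: A) k =
    (if k is j.+1 then weighted_partitions w A j else 0) +
    (a * #|A| + b * k) * weighted_partitions w A k)%N.
Proof.
move=> w1 wS xA; rewrite /weighted_partitions sum_partition_setU1 // big_split /=.
congr addn.
  rewrite (eq_bigr (fun P : {set {set T}} =>
     (#|P|.+1 == k) * \prod_(B in P) w #|B|)%N) => [|P partP].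
    by case: k => [|j] //; rewrite big1.
  have xP : [set x] \notin P.
    by apply/negP => /(partitionS partP); rewrite sub1set (negPf xA).
  by rewrite big_setU1 //= cards1 w1 mul1n cardsU1 xP.
rewrite big_distrr /=; apply: eq_bigr => P partP.
have grow B : B \in P ->
    ((#|(x |: B) |: P :\ B| == k) * \prod_(C in (x |: B) |: P :\ B) w #|C| =
     (a * #|B| + b) * ((#|P| == k) * \prod_(C in P) w #|C|))%N.
  move=> BP; have xB : x \notin B.
    by apply/negP => /(subsetP (partitionS partP BP)); rewrite (negPf xA).
  have xBP : x |: B \notin P :\ B.
    apply/negP => /setD1P[_ /(partitionS partP)].
    by rewrite subUset sub1set (negPf xA).
  rewrite cardsU1 xBP (cardsD1 B P) BP big_setU1 //= [in RHS](big_setD1 B) //=.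
  rewrite cardsU1 xB; have := partition_neq0 partP BP; rewrite -card_gt0.
  by case: #|B| => // m _; rewrite add1n wS -!mulnA mulnCA.
rewrite (eq_bigr _ grow) -big_distrl big_split /= -big_distrr /=.
rewrite -(card_partition partP) sum_nat_const [(_ * b)%N]mulnC.
by have [-> | _] := eqVneq #|P| k; rewrite ?mul0n ?muln0.
Qed.

(** The array of which the Stirling numbers (a = 0, b = 1) and the Lah numbers
    (a = b = 1) are cases. *)
Fixpoint triangle (a b n k : nat) : nat :=
  match n with
  | 0 => k == 0
  | n'.+1 => (if k is k'.+1 then triangle a b n' k' else 0) +
             (a * n' + b * k) * triangle a b n' k
  end%N.

Lemma weighted_partitionsE (w : nat -> nat) a b (T : finType) (D : {set T}) k :
    w 1 = 1%N -> (forall m, w m.+2 = (a * m.+1 + b) * w m.+1)%N ->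
  weighted_partitions w D k = triangle a b #|D| k.
Proof.
move=> w1 wS; move cardD: #|D| => n; elim: n D k cardD => [|n IHn] D k cardD.
  rewrite /weighted_partitions (big_pred1 set0) => [|P]; last first.
    by move/cards0_eq: cardD => ->; rewrite partition_set0.
  by rewrite cards0 big_set0 muln1 /= eq_sym.
have [x xD] : exists x, x \in D by apply/card_gt0P; rewrite cardD.
have cardA : #|D :\ x| = n by move: cardD; rewrite (cardsD1 x) xD => -[].
rewrite -(setD1K xD) (weighted_partitions_setU1 _ w1 wS) ?setD11 // cardA IHn //.
by case: k => [|k] //=; rewrite IHn.
Qed.

(** * Counting linear orders *)

Lemma linear_ordersP (T : finType) (B : {set T}) (R : {set T * T}) :
  reflect [/\ forall x y, (x, y) \in R -> x \in B /\ y \in B,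
              forall x y, x \in B -> y \in B -> (x, y) \in R \/ (y, x) \in R,
              forall x y, (x, y) \in R -> (y, x) \in R -> x = y &
              forall x y z, (x, y) \in R -> (y, z) \in R -> (x, z) \in R]
    (R \in linear_orders B).
Proof.
rewrite inE; apply: (iffP and4P) => -[sub tot asym trans]; split.
- by move=> x y /(subsetP sub)/setXP.
- by move=> x y xB yB; have /forall_inP/(_ _ yB)/orP := forall_inP tot _ xB.
- by move=> x y xy yx; apply/eqP/(implyP (forallP (forallP asym x) y))/andP.
- move=> x y z xy yz.
  by apply/(implyP (forallP (forallP (forallP trans x) y) z))/andP.
- by apply/subsetP => -[x y] /sub[xB yB]; apply/setXP.
- by apply/forall_inP => x xB; apply/forall_inP => y yB; apply/orP/tot.
- apply/forallP => x; apply/forallP => y; apply/implyP => /andP[xy yx].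
  exact/eqP/asym.
apply/forallP => x; apply/forallP => y; apply/forallP => z.
by apply/implyP => /andP[]; apply: trans.
Qed.

(** An element with the most elements below it is above everything. *)
Lemma linear_order_max (T : finType) (B : {set T}) R :
    R \in linear_orders B -> B != set0 ->
  exists2 m, m \in B & forall x, x \in B -> (x, m) \in R.
Proof.
case/linear_ordersP => sub tot asym trans /set0Pn[x0 x0B].
case: (arg_maxnP (fun m => #|[set x | (x, m) \in R]|) x0B) => m mB max_m.
exists m => // x xB; case: (tot x m xB mB) => // mx.
have sub_down : [set y | (y, m) \in R] \subset [set y | (y, x) \in R].
  by apply/subsetP => y; rewrite !inE => /trans/(_ mx).
have /subset_cardP/(_ sub_down)/(_ x) :
    #|[set y | (y, m) \in R]| = #|[set y | (y, x) \in R]|.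
  by apply/eqP; rewrite eqn_leq subset_leq_card //; apply: max_m.
by rewrite !inE => ->; case: (tot x x xB xB).
Qed.

(** Deleting the greatest element [m], or putting [m] on top of an order on the
    rest, are mutually inverse. *)
Lemma card_linear_orders_max (T : finType) (B : {set T}) m : m \in B ->
  #|[set R in linear_orders B | [forall x in B, (x, m) \in R]]| =
  #|linear_orders (B :\ m)|.
Proof.
move=> mB; pose cut (R : {set T * T}) := R :&: setX (B :\ m) (B :\ m).
pose add (R : {set T * T}) := R :|: setX B [set m].
have cutP R : R \in linear_orders B -> [forall x in B, (x, m) \in R] ->
    cut R \in linear_orders (B :\ m) /\ add (cut R) = R.
  case/linear_ordersP => sub tot asym trans /forall_inP max_m; split.
    apply/linear_ordersP; split.
    - by move=> x y /setIP[_ /setXP].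
    - move=> x y xB yB; rewrite !in_setI !in_setX xB yB !andbT.
      by case/setD1P: xB => _; case/setD1P: yB => _ yB /tot; apply.
    - by move=> x y /setIP[xy _] /setIP[yx _]; apply: asym.
    move=> x y z /setIP[xy /setXP[xB _]] /setIP[yz /setXP[_ zB]].
    by rewrite in_setI in_setX xB zB (trans _ _ _ xy yz).
  apply/setP => -[x y]; rewrite !inE /=; apply/idP/idP.
    by case/orP => [/and3P[]|/andP[xB /eqP ->]] //; apply: max_m.
  move=> xy; have [xB yB] := sub _ _ xy; rewrite xy xB yB /= !andbT.
  have [//|neq_ym] := eqVneq y m; first by rewrite orbT.
  rewrite orbF andbT; apply: contraNneq neq_ym => eq_xm; apply/eqP.
  by apply: asym; [apply: max_m | rewrite -eq_xm].
have addP R : R \in linear_orders (B :\ m) ->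
    [/\ add R \in linear_orders B, [forall x in B, (x, m) \in add R]
       & cut (add R) = R].
  case/linear_ordersP => sub tot asym trans.
  have sub' x y : (x, y) \in R -> [/\ x != m, x \in B, y != m & y \in B].
    by case/sub => /setD1P[xm xB] /setD1P[].
  split.
  - apply/linear_ordersP; split.
    + move=> x y; rewrite !inE /= => /orP[/sub'[]|/andP[xB /eqP ->]] //.
    + move=> x y xB yB; rewrite !inE /= xB yB.
      have [_|xm] := eqVneq x m; first by right; rewrite orbT.
      have [_|ym] := eqVneq y m; first by left; rewrite orbT.
      by rewrite !orbF; apply: tot; apply/setD1P.
    + move=> x y; rewrite !inE /=.
      case/orP => [xy|/andP[xB /eqP ym]] /orP[yx|/andP[yB /eqP xm]].
      * exact: asym.
      * by case/sub': xy; rewrite xm eqxx.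
      * by case/sub': yx; rewrite ym eqxx.
      * by rewrite xm ym.
    move=> x y z; rewrite !inE /=.
    case/orP => [xy|/andP[xB /eqP ->]] /orP[yz|/andP[yB /eqP ->]].
    + by rewrite (trans _ _ _ xy yz).
    + by case/sub': xy => _ -> _ _; rewrite eqxx orbT.
    + by case/sub': yz; rewrite eqxx.
    + by rewrite xB eqxx orbT.
  - by apply/forall_inP => x xB; rewrite !inE /= xB eqxx orbT.
  apply/setP => -[x y]; rewrite !inE /=; apply/idP/idP.
    by case/andP => /orP[//|/andP[_ /eqP ->]]; rewrite eqxx !andbF.
  by move=> xy; rewrite xy; case/sub': xy => -> -> -> ->.
rewrite -[RHS](card_in_imset (f := add)); last first.
  by apply: (can_in_inj (g := cut)) => R /addP[].
apply: eq_card => R; rewrite [LHS]inE; apply/andP/imsetP => [[lR mR]|[R' lR' ->]].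
  by have [cR <-] := cutP R lR mR; exists (cut R).
by case: (addP R' lR').
Qed.

(** Sorting the linear orders by their greatest element gives the recurrence of
    the factorial. *)
Lemma card_linear_orders (T : finType) (B : {set T}) :
  #|linear_orders B| = #|B|`!%N.
Proof.
move cardB: #|B| => n; elim: n B cardB => [|n IHn] B cardB.
  move/cards0_eq: cardB => ->; rewrite fact0 -(cards1 (set0 : {set T * T})).
  apply: eq_card => R; rewrite [RHS]inE; apply/linear_ordersP/eqP => [[sub _ _ _]|->].
    by apply/setP => -[x y]; rewrite inE; apply/negP => /sub[]; rewrite inE.
  by split=> x y; rewrite ?inE.
have B0 : B != set0 by rewrite -card_gt0 cardB.
transitivity (\sum_(m in B) #|linear_orders (B :\ m)|)%N; last first.
  rewrite (eq_bigr (fun=> n`!)) => [|m mB]; first by rewrite sum_nat_const cardB.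
  by apply: IHn; move: cardB; rewrite (cardsD1 m) mB => -[].
rewrite -sum1_card.
(* The inner sum is 1, as each order has exactly one greatest element. *)
transitivity (\sum_(R in linear_orders B)
    \sum_(m in B) [forall x in B, (x, m) \in R])%N.
  apply: eq_bigr => R lR; have [m mB max_m] := linear_order_max lR B0.
  rewrite (bigD1 m) //= (introT forall_inP max_m) big1 // => m' /andP[m'B neq].
  case: forall_inP => // max_m'; case/linear_ordersP: lR => _ _ asym _.
  by rewrite (asym m' m) ?eqxx ?max_m ?max_m' // in neq.
rewrite exchange_big /=; apply: eq_bigr => m mB.
rewrite -card_linear_orders_max // -sum1_card -big_mkcondr /=.
by apply: eq_bigl => R; rewrite [RHS]inE.
Qed.

(** * The two triangles and their inversion *)

Lemma stirling2_triangle n k : stirling2 n k = triangle 0 1 n k.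
Proof.
rewrite -{2}(card_ord n) -cardsT.
rewrite -(@weighted_partitionsE (fun=> 1%N)) //.
rewrite /stirling2 /weighted_partitions cardsE -sum1_card big_mkcondr /=.
by apply: eq_bigr => P _; rewrite big1 // muln1; case: eqP.
Qed.

Lemma lah_triangle n k : lah n k = triangle 1 1 n k.
Proof.
rewrite -{2}(card_ord n) -cardsT -(@weighted_partitionsE factorial) //; last first.
  by move=> m; rewrite mul1n addn1 factS.
rewrite /lah /weighted_partitions cardsE -sum1_card.
rewrite (eq_bigl (fun Pf : _ * _ => (partition Pf.1 [set: 'I_n]) &&
   ((#|Pf.1| == k) && (Pf.2 \in pfamily set0 Pf.1 (@linear_orders 'I_n))))) //.
rewrite -(pair_big_dep (fun P => partition P [set: 'I_n])
   (fun P f => (#|P| == k) && (f \in pfamily set0 P (@linear_orders 'I_n)))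
   (fun _ _ => 1%N)) /=.
apply: eq_bigr => P _; case: eqP => _; last by rewrite big_pred0_eq.
rewrite mul1n sum1_card card_pfamily foldrE big_map big_enum /=.
by apply: eq_bigr => B _; apply: card_linear_orders.
Qed.

Lemma triangle_small a b n k : (n < k)%N -> triangle a b n k = 0%N.
Proof.
elim: n k => [|n IHn] [|k] //= lt_nk.
by rewrite !IHn ?muln0 // ltnW.
Qed.

(** The left-hand side satisfies the recurrence of [triangle 0 1]: the term k in
    the recurrence of [triangle 0 1 n.+1 k], with its sign changed, cancels the
    k in the factor k + j of the recurrence of [triangle 1 1 k.+1 j]. *)
Lemma lah_stirling2 n j :
  \sum_(0 <= k < n.+1)
     (-1) ^+ (n - k)%N * (triangle 1 1 k j)%:Z * (triangle 0 1 n k)%:Z =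
  (triangle 0 1 n j)%:Z.
Proof.
elim: n j => [|n IHn] j; first by rewrite big_nat1 mul1r mulr1.
pose L k j := (triangle 1 1 k j)%:Z; pose S n k := (triangle 0 1 n k)%:Z.
pose prev (f : nat -> int) k : int := if k is k'.+1 then f k' else 0.
have S_rec k : S n.+1 k = prev (S n) k + k%:Z * S n k.
  by rewrite /S /prev /= mul0n mul1n PoszD PoszM; case: k.
have L_rec k : L k.+1 j = prev (L k) j + (k%:Z + j%:Z) * L k j.
  by rewrite /L /prev /= PoszD PoszM PoszD !mul1n; case: j.
have S_small : S n n.+1 = 0 by rewrite /S triangle_small.
transitivity (\sum_(0 <= k < n.+1)
    (-1) ^+ (n - k) * (L k.+1 j - k%:Z * L k j) * S n k).
  transitivity (
      \sum_(0 <= k < n.+2) (-1) ^+ (n.+1 - k) * L k j * prev (S n) k +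
      \sum_(0 <= k < n.+2) (-1) ^+ (n.+1 - k) * L k j * (k%:Z * S n k)).
    by rewrite -big_split; apply: eq_bigr => k _; rewrite /= -mulrDr -S_rec.
  rewrite big_nat_recl //= mulr0 add0r.
  rewrite [X in _ + X]big_nat_recr //= S_small !mulr0 addr0.
  rewrite -big_split; apply: eq_big_nat => k /andP[_ le_kn] /=.
  by rewrite subSS subSn // exprS; ring.
rewrite (eq_bigr (fun k => (-1) ^+ (n - k) * prev (L k) j * S n k +
    j%:Z * ((-1) ^+ (n - k) * L k j * S n k))) => [|k _]; last first.
  by rewrite L_rec; ring.
rewrite big_split -big_distrr /= IHn -/(S n j) -/(S n.+1 j) S_rec; congr (_ + _).
case: j {L_rec} => [|j] /=; last by rewrite IHn.
by rewrite big1 // => k _; rewrite mulr0 mul0r.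
Qed.

Theorem theorem2 (n : nat) :
  (bell n)%:Z =
  \sum_(0 <= k < n.+1) (-1) ^+ (n - k)%N * (lah_bell k)%:Z * (stirling2 n k)%:Z.
Proof.
(* All inner sums get the same range, so that the two sums can be exchanged. *)
have widen k : (k <= n)%N ->
    (lah_bell k)%:Z = \sum_(0 <= j < n.+1) (triangle 1 1 k j)%:Z.
  move=> le_kn; rewrite [in RHS](big_cat_nat (n := k.+1)) //= [X in _ + X]big_nat_cond.
  rewrite [X in _ + X]big1 ?addr0 => [|j /andP[/andP[lt_kj _] _]]; last first.
    by rewrite triangle_small.
  rewrite /lah_bell (big_morph Posz PoszD (erefl _)).
  by apply: eq_bigr => j _; rewrite lah_triangle.
under eq_big_nat => k /andP[_ le_kn].
  rewrite widen // stirling2_triangle big_distrr big_distrl /=.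
  over.
rewrite exchange_big_nat /= /bell (big_morph Posz PoszD (erefl _)).
by apply: eq_bigr => j _; rewrite stirling2_triangle lah_stirling2.
Qed.
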